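(* If $G$ is a graph of order $n \ge 3$ with minimum degree $\delta(G) \ge 1$, then $\operatorname{fd}(G) \le n-2$. Moreover, this bound is sharp: there are infinitely many graphs $G$ with $\delta(G) \ge 1$ satisfying $\operatorname{fd}(G) = |V(G)| - 2$.
   Context: All graphs are finite and simple; $N(v)$ denotes the open neighborhood of $v$. For a graph $G=(V,E)$ and an integer $k \ge 1$, a $k$-fair dominating set is a dominating set $D \subseteq V$ such that $|N(v) \cap D| = k$ for every $v \in V \setminus D$ (the set $D = V$ qualifies vacuously). A fair dominating set (FD-set) is a set that is a $k$-fair dominating set for some $k \ge 1$. If $G$ has at least one edge, $\operatorname{fd}(G)$ is the minimum cardinality of an FD-set of $G$; by convention, $\operatorname{fd}(\overline{K_n}) = n$ for the edgeless graph on $n$ vertices. *)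

(* Defs.v *)
From HB Require Import structures.
From mathcomp Require Import all_boot.

Set Implicit Arguments.
Unset Strict Implicit.
Unset Printing Implicit Defensive.

Record sgraph := SGraph {
  vertex :> finType;
  adj : rel vertex;
  adj_sym : symmetric adj;
  adj_irrefl : irreflexive adj
}.

Section FairDomination.
Variable G : sgraph.
Implicit Types (u v : G) (D : {set G}) (k : nat).

Definition nbhd v : {set G} := [set u | adj v u].

Definition degree v : nat := #|nbhd v|.

(* Every degree is less than #|G|, so the default value #|G| never wins when
   G has a vertex; the graph without vertices gets minimum degree 0. *)
Definition min_degree : nat := \big[minn/#|G|]_(v : G) degree v.

Definition edgeless : bool := [forall u : G, forall v : G, ~~ adj u v].

Definition dominating D : bool :=
  [forall (v | v \notin D), exists u in D, adj v u].

Definition fair_dominating k D : bool :=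
  [&& 0 < k, dominating D & [forall (v | v \notin D), #|nbhd v :&: D| == k]].

Definition FD_set D : Prop := exists k, fair_dominating k D.

(* Decidable form of FD_set: unless D = V, the integer k is at most #|G|, and
   for D = V one may take k = 1. *)
Definition FD_setb D : bool := [exists k : 'I_(#|G|.+2), fair_dominating k D].

Lemma FD_setP D : reflect (FD_set D) (FD_setb D).
Proof.
apply: (iffP existsP) => [[k kD]|[k kD]]; first by exists k.
have [/set0Pn[v]|DT] := boolP (~: D != set0).
  rewrite inE => vD; case/and3P: (kD) => _ _ /forall_inP/(_ v vD)/eqP def_k.
  have lek : k < #|G|.+2 by rewrite -def_k ltnS (leq_trans (max_card _)).
  by exists (Ordinal lek).
exists (inord 1); rewrite /fair_dominating inordK //=.
have memD v : v \in D.
  by apply: contraNT DT => vD; apply/set0Pn; exists v; rewrite inE.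
by apply/andP; split; apply/forall_inP=> v; rewrite memD.
Qed.

Lemma FD_setT : FD_set [set: G].
Proof.
by exists 1; apply/and3P; split=> //; apply/forall_inP=> v; rewrite inE.
Qed.

Definition fd : nat :=
  if edgeless then #|G|
  else #|[arg min_(D < [set: G] | FD_setb D) #|D| ]|.

Lemma fdP : ~~ edgeless ->
  (exists2 D, FD_set D & #|D| = fd) /\ (forall D, FD_set D -> fd <= #|D|).
Proof.
rewrite /fd => /negbTE->; case: arg_minnP => [|D /FD_setP FD minD].
  exact/FD_setP/FD_setT.
by split=> [|D' /FD_setP/minD//]; exists D.
Qed.

End FairDomination.

Definition isomorphic (G H : sgraph) : Prop :=
  exists f : G -> H, bijective f /\ {mono f : u v / adj u v}.

(* Main.v *)
Require Import Defs.
From mathcomp Require Import all_boot.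

Set Implicit Arguments.
Unset Strict Implicit.
Unset Printing Implicit Defensive.

(** Upper bound: if [u] and [v] have the same degree and are nonadjacent, or
    have degree at least 2, then the complement of [{u, v}] is an FD-set.  If no
    such pair exists, then any two vertices of equal degree form a component
    K_2, so degrees are pairwise distinct on the closed neighborhood of a vertex
    of maximum degree Delta (and Delta >= 2, as n >= 3); but these are Delta + 1
    numbers between 1 and Delta.

    Sharpness: take a clique x_0, ..., x_(n+1) and an independent set
    y_0, ..., y_(n+1), with x_i adjacent to y_j if and only if j <= i, except
    that x_(n+1) and y_0 are not adjacent.  Let D be an FD-set.  Outside D, all
    vertices have equally many neighbors in D, so an inclusion between two such
    neighborhoods is an equality.  If both some x and some y lie outside D, the
    neighborhood of y in D is contained in that of x; equality propagates until
    a contradiction is reached.  If only x's, or only y's, lie outside D, there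
    are at most two of them because their neighborhoods form a strict chain,
    x_(n+1) and y_0 excepted. *)

(** * The upper bound *)

Section Graph.
Variable G : sgraph.
Implicit Types (u v w z : G) (D : {set G}).

Lemma min_degree_le v : min_degree G <= degree v.
Proof.
rewrite /min_degree; have: v \in index_enum G by rewrite mem_index_enum.
elim: (index_enum G) => // u s IHs; rewrite inE big_cons geq_min.
by case/predU1P=> [<-|/IHs->]; rewrite ?leqnn ?orbT.
Qed.

Lemma degree_gt0 u v : adj u v -> 0 < degree u.
Proof. by move=> uv; apply/card_gt0P; exists v; rewrite inE. Qed.

Lemma min_degree_gt0 : 0 < #|G| -> (forall u, exists v, adj u v) ->
  0 < min_degree G.
Proof.
move=> G_gt0 nbr; rewrite /min_degree; elim/big_ind: _ => // [m n m0 n0|u _].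
  by rewrite leq_min m0.
by have [v /degree_gt0] := nbr u.
Qed.

Lemma not_edgeless u : 0 < degree u -> ~~ edgeless G.
Proof.
case/card_gt0P=> v; rewrite inE => uv.
by apply/forallPn; exists u; apply/forallPn; exists v; rewrite negbK.
Qed.

Lemma fair_nbhd k D v w : fair_dominating k D -> v \notin D -> w \notin D ->
    (forall z, z \in D -> adj v z -> adj w z) ->
  forall z, z \in D -> adj w z -> adj v z.
Proof.
case/and3P=> _ _ /forall_inP fD vD wD sub z zD wz.
have /setP/(_ z): nbhd v :&: D = nbhd w :&: D.
  apply/eqP; rewrite eqEcard (eqP (fD v vD)) (eqP (fD w wD)) leqnn andbT.
  by apply/subsetP=> y; rewrite !inE => /andP[vy yD]; rewrite yD sub.
by rewrite !inE zD wz !andbT.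
Qed.

Lemma fair_nbr k D v : fair_dominating k D -> v \notin D ->
  exists2 z, z \in D & adj v z.
Proof. by case/and3P=> _ /forall_inP dom _ /dom/exists_inP[z]; exists z. Qed.

(** The last hypothesis covers two cases: [u], [v] nonadjacent of positive degree, or adjacent of
    degree at least 2. Either vertex loses only the other one, if adjacent, when its neighborhood is
    cut down to [D]. *)
Lemma fd_le_pair u v : u != v -> degree u = degree v ->
  adj u v < degree u -> fd G <= #|G| - 2.
Proof.
move=> neq_uv deg_uv gt_uv; set D := ~: [set u; v].
have cardD : #|D| = #|G| - 2 by rewrite cardsCs setCK cards2 neq_uv.
have nbhdD x y : x \in [set u; v] -> (y = if x == u then v else u) ->
    #|nbhd x :&: D| = degree u - adj u v.
  rewrite !inE => xuv def_y.
  have -> : nbhd x :&: D = nbhd x :\ y.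
    apply/setP=> z; rewrite !inE negb_or def_y andbC.
    case: eqP xuv => [-> _|_ /= /eqP->].
      by case: (z =P u) => [->|]; rewrite ?adj_irrefl ?andbF.
    by case: (z =P v) => [->|]; rewrite ?adj_irrefl ?andbF ?andbT.
  have -> : degree u = degree x by case/orP: xuv => /eqP->.
  rewrite /degree (cardsD1 y (nbhd x)) inE.
  have -> : adj x y = adj u v.
    rewrite def_y; case: eqP xuv => [-> //|_ /= /eqP->]; exact: adj_sym.
  by rewrite addKn.
have fairD : fair_dominating (degree u - adj u v) D.
  have nbD x : x \notin D -> #|nbhd x :&: D| = degree u - adj u v.
    by rewrite inE negbK => /nbhdD; apply.
  apply/and3P; split; first by rewrite subn_gt0.
    apply/forall_inP=> x /nbD cardx; apply/exists_inP.
    have /card_gt0P[z] : 0 < #|nbhd x :&: D| by rewrite cardx subn_gt0.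
    by rewrite !inE => /andP[xz zD]; exists z; rewrite // !inE.
  by apply/forall_inP=> x /nbD->.
have [_ min_fd] := fdP (not_edgeless (leq_ltn_trans (leq0n _) gt_uv)).
by rewrite -cardD; apply: min_fd; exists (degree u - adj u v).
Qed.

Lemma fd_upper_bound : 3 <= #|G| -> 1 <= min_degree G -> fd G <= #|G| - 2.
Proof.
move=> G_ge3 deg_min; have deg_gt0 v := leq_trans deg_min (min_degree_le v).
rewrite leqNgt; apply/negP=> gt_fd.
have eq_deg u v : u != v -> degree u = degree v -> adj u v /\ degree u = 1.
  move=> neq_uv deg_uv; have: ~~ (adj u v < degree u).
    by apply: contraL gt_fd => /(fd_le_pair neq_uv deg_uv); rewrite leqNgt.
  rewrite -leqNgt; case: (adj u v) => /= le_u.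
    by split=> //; apply/eqP; rewrite eqn_leq le_u deg_gt0.
  by have := leq_trans (deg_gt0 u) le_u.
have /card_gt0P[w0 _] : 0 < #|G| by apply: leq_trans G_ge3.
have [w _ max_w] := @arg_maxnP G w0 predT (@degree G) isT.
have {}max_w v : degree v <= degree w by apply: max_w.
(* If all degrees were 1, [eq_deg] would make [w] adjacent to the at least two other vertices. *)
have w_gt1 : 1 < degree w.
  rewrite ltnNge; apply/negP=> w_le1.
  have deg1 v : degree v = 1.
    by apply/eqP; rewrite eqn_leq deg_gt0 (leq_trans (max_w v)).
  have: #|[set~ w]| <= degree w.
    apply/subset_leq_card/subsetP=> v; rewrite !inE eq_sym => neq_wv.
    by case: (eq_deg w v neq_wv); rewrite ?deg1.
  by rewrite deg1 cardsC1 leqNgt -ltnS prednK ?G_ge3 // (leq_trans _ G_ge3).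
have uniq_deg : uniq [seq degree v | v <- enum (w |: nbhd w)].
  rewrite map_inj_in_uniq ?enum_uniq // => u v; rewrite !mem_enum !inE => uw vw.
  move=> deg_uv; apply/eqP; apply: contraLR w_gt1 => neq_uv.
  have [uv deg_u1] := eq_deg u v neq_uv deg_uv; rewrite -leqNgt.
  case/predU1P: uw => [<-|wu]; first by rewrite deg_u1.
  case/predU1P: vw => [<-|wv]; first by rewrite -deg_uv deg_u1.
  have neq_vw : v != w by apply: contraTneq wv => ->; rewrite adj_irrefl.
  (* With both different from [w], the degree-1 vertex [u] would have the two neighbors [v] and
     [w]. *)
  have: #|[set v; w]| <= degree u.
    by apply/subset_leq_card/subsetP=> z; rewrite !inE => /pred2P[]->;
       rewrite // adj_sym.
  by rewrite cards2 neq_vw deg_u1.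
have /(uniq_leq_size uniq_deg) : {subset [seq degree v | v <- enum (w |: nbhd w)]
                                  <= iota 1 (degree w)}.
  by move=> _ /mapP[v _ ->]; rewrite mem_iota deg_gt0 add1n ltnS max_w.
by rewrite size_map -cardE size_iota cardsU1 inE adj_irrefl ltnn.
Qed.

End Graph.

(** * Sharpness: the extremal family *)

Section HalfGraph.
Variable n : nat.

(* [inl i] is x_i and [inr j] is y_j; the bound [i < j + n.+1] only excludes
   i = n + 1, j = 0. *)
Definition half_adj : rel ('I_n.+2 + 'I_n.+2) := fun u v =>
  match u, v with
  | inl i, inl j => i != j
  | inl i, inr j | inr j, inl i => j <= i < j + n.+1
  | inr _, inr _ => false
  end.

Lemma half_adj_sym : symmetric half_adj.
Proof. by case=> i [] j //=; rewrite eq_sym. Qed.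

Lemma half_adj_irrefl : irreflexive half_adj.
Proof. by case=> i //=; rewrite eqxx. Qed.

Definition half_graph := SGraph half_adj_sym half_adj_irrefl.

Local Notation x i := (inl i : half_graph).
Local Notation y j := (inr j : half_graph).

Lemma card_half_graph : #|half_graph| = n.*2.+4.
Proof. by rewrite card_sum card_ord addnn doubleS doubleS. Qed.

Lemma half_graph_nbr (u : half_graph) : exists v : half_graph, adj u v.
Proof.
case: u => [i|j].
  by exists (y i); rewrite /= leqnn addnS ltnS leq_addr.
by exists (x j); rewrite /= leqnn addnS ltnS leq_addr.
Qed.

Section FairSet.
Variables (k : nat) (D : {set half_graph}).
Hypothesis fairD : fair_dominating k D.

(** All neighbors of [y j] are clique vertices, and those in [D] differ from [x i], hence are
    adjacent to it; fairness reverses this inclusion. *)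
Lemma half_nbhd_eq i j : x i \notin D -> y j \notin D ->
  forall z : half_graph, z \in D -> adj (x i) z -> adj (y j) z.
Proof.
move=> xD yD; apply: (fair_nbhd fairD yD xD) => -[i'|j'] //= zD _.
by apply: contraNneq xD => ->.
Qed.

Lemma half_one_side i j : x i \notin D -> y j \notin D -> False.
Proof.
have lastP (m : 'I_n.+2) : m <= n.+1 by rewrite -ltnS.
move=> xD yD; have nbr := half_nbhd_eq.
have [y0D|y0D] := boolP (y ord0 \in D).
  have def_i : i = ord_max.
    apply/val_inj/eqP; rewrite eqn_leq lastP leqNgt /=.
    by apply/negP=> lt_i; have := nbr i j xD yD _ y0D lt_i.
  have ymD : y ord_max \notin D.
    apply/negP=> ymD; have := nbr i j xD yD _ ymD.
    by rewrite def_i /= leqnn addnS ltnS leq_addr => /(_ isT).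
  have x0D : x ord0 \notin D.
    apply/negP=> x0D; have := nbr i _ xD ymD _ x0D.
    by rewrite def_i => /(_ isT).
  by have /(_ isT) := nbr _ _ x0D yD _ y0D.
(* Here the missing edge matters: [x ord_max] is adjacent to [x i] but not to [y ord0]. *)
have xmD : x ord_max \notin D.
  apply/negP=> xmD; have := nbr _ _ xD y0D _ xmD.
  have neq_i : i != ord_max by apply: contraNneq xD => ->.
  by rewrite /= ltnn => /(_ neq_i).
have ymD : y ord_max \notin D.
  apply/negP=> ymD; have := nbr _ _ xmD y0D _ ymD.
  by rewrite /= leqnn addnS ltnS leq_addr => /(_ isT).
(* By domination [y ord0] has a neighbor [x i'] in [D]; equality with [y ord_max] forces
   [i' = n.+1]. *)
have [[i'|//] zD _] := fair_nbr fairD y0D.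
have neq_i' : ord_max != i' by apply: contraNneq xmD => ->.
have := nbr _ _ xmD ymD _ zD neq_i'; rewrite /= leqNgt ltn_neqAle lastP.
by rewrite eq_sym andbT -(inj_eq val_inj) in neq_i' *; rewrite neq_i'.
Qed.

Lemma half_FD_large : #|half_graph| - 2 <= #|D|.
Proof.
rewrite leq_subLR -(cardsC D) addnC leq_add2r leqNgt; apply/negP=> gt2.
(* Three vertices outside [D] leave two after discarding the exceptional [z], later [x ord_max] or
   [y ord0]. *)
have pair (z : half_graph) : exists u v, [/\ u \notin D, v \notin D, u != z,
    v != z & u != v].
  have: 1 < #|~: D :\ z|.
    by move: gt2; rewrite (cardsD1 z); case: (z \in _) => //= /ltnW.
  by case/card_gt1P=> u [v []]; rewrite !inE => /andP[uz uD] /andP[vz vD];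
     exists u, v.
have [allx|ally] : (forall j, y j \in D) \/ (forall i, x i \in D).
  have [/forallP|/forallPn[j yD]] := boolP [forall j, y j \in D]; first by left.
  right=> i; apply/negPn/negP=> xD; exact: half_one_side xD yD.
- have [[i|j] [[i'|j'] [uD vD uz vz uv]]] := pair (x ord_max); last 3 first.
  + by rewrite allx in vD.
  + by rewrite allx in uD.
  + by rewrite allx in uD.
  wlog lt_ii' : i i' uD vD uz vz uv / i < i'.
    move=> IH; have [/IH|/IH|eq_ii'] := ltngtP i i'; [exact|apply=> //|].
      by rewrite eq_sym.
    by rewrite (val_inj eq_ii') eqxx in uv.
  have ltmax (m : 'I_n.+2) : x m != x ord_max -> m < n.+1.
    by move=> neq; rewrite ltn_neqAle -ltnS ltn_ord andbT.
  have sub (z : half_graph) : z \in D -> adj (x i) z -> adj (x i') z.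
    case: z => l zD /=; first by move=> _; apply: contraNneq vD => ->.
    case/andP=> le_l _; rewrite (leq_trans le_l (ltnW lt_ii')).
    by rewrite (leq_trans (ltmax _ vz)) // leq_addl.
  (* The inclusion is strict: [y i'] is adjacent to [x i'] but not to [x i]. *)
  have := fair_nbhd fairD uD vD sub (allx i').
  by rewrite /= leqnn addnS ltnS leq_addr leqNgt lt_ii' => /(_ isT).
have [[i|j] [[i'|j'] [uD vD uz vz uv]]] := pair (y ord0).
- by rewrite ally in uD.
- by rewrite ally in uD.
- by rewrite ally in vD.
wlog lt_jj' : j j' uD vD uz vz uv / j < j'.
  move=> IH; have [/IH|/IH|eq_jj'] := ltngtP j j'; [exact|apply=> //|].
    by rewrite eq_sym.
  by rewrite (val_inj eq_jj') eqxx in uv.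
have gt0 (m : 'I_n.+2) : y m != y ord0 -> 0 < m.
  by rewrite lt0n.
have sub (z : half_graph) : z \in D -> adj (y j') z -> adj (y j) z.
  case: z => l zD //= /andP[le_l _]; rewrite (leq_trans (ltnW lt_jj') le_l) /=.
  exact: leq_trans (ltn_ord l) (leq_add (gt0 _ uz) (leqnn n.+1)).
(* Here [x j] is adjacent to [y j] but not to [y j']. *)
have := fair_nbhd fairD vD uD sub (ally j).
by rewrite /= leqnn addnS ltnS leq_addr [j' <= j]leqNgt lt_jj' => /(_ isT).
Qed.

End FairSet.

Lemma half_graph_extremal :
  [/\ 3 <= #|half_graph|, 1 <= min_degree half_graph
    & fd half_graph = #|half_graph| - 2].
Proof.
have card3 : 3 <= #|half_graph| by rewrite card_half_graph.
have deg1 : 1 <= min_degree half_graph.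
  by apply: min_degree_gt0 half_graph_nbr; apply: leq_trans card3.
split=> //; apply/eqP; rewrite eqn_leq fd_upper_bound //=.
have [v /degree_gt0/not_edgeless] := half_graph_nbr (x ord0).
by case/fdP=> -[D [k fairD] <-] _; apply: half_FD_large fairD.
Qed.

End HalfGraph.

Lemma isomorphic_card (G H : sgraph) : isomorphic G H -> #|G| = #|H|.
Proof. by case=> f [/bij_eq_card]. Qed.

Theorem theorem2 :
  (forall G : sgraph,
     3 <= #|G| -> 1 <= min_degree G -> fd G <= #|G| - 2) /\
  (exists G : nat -> sgraph,
     (forall i j : nat, i <> j -> ~ isomorphic (G i) (G j)) /\
     (forall i : nat,
        [/\ 3 <= #|G i|, 1 <= min_degree (G i) & fd (G i) = #|G i| - 2])).
Proof.
split; first exact: fd_upper_bound.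
(* Distinct parameters give distinct orders, hence nonisomorphic graphs. *)
exists half_graph; split=> [i j neq_ij /isomorphic_card|]; last first.
  exact: half_graph_extremal.
by rewrite !card_half_graph => -[/double_inj].
Qed.
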